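(* Let $X$ be a compact, metric and totally disconnected space and let $f \colon X \to X$ be continuous. The following statements are equivalent: (i) $(X, f)$ admits dynamical $\epsilon$-partitions for every $\epsilon > 0$. (ii) The $\omega$-limit of every point in $X$ is either a periodic orbit or an adding machine; moreover, these $\omega$-limits are stable with respect to clopen sets.
   Context: A dynamical $\epsilon$-partition $\mathcal U$ of $(X,f)$ is a finite partition of $X$ into clopen (simultaneously closed and open) subsets of diameter smaller than $\epsilon$ such that for every $U \in \mathcal U$ there is $U' \in \mathcal U$ (possibly $U'=U$) with $f(U) \subset U'$. The $\omega$-limit of $p \in X$ is $\omega(p) = \bigcap_{N \ge 0} \overline{\{f^n(p) : n \geq N\}}$. An adding machine is a dynamical system (topologically conjugate to) the inverse limit of an inverse sequence of systems $(P_n,\tau_n)$, $n\ge 1$, where each $P_n$ is a finite discrete space on which $\tau_n$ acts as a single periodic orbit (a cyclic permutation), the bonding maps $P_{n+1} \to P_n$ commute with the $\tau_n$, and the cardinalities of the $P_n$ (the periods) tend to infinity. Saying that $\omega(p)$ is an adding machine means that $(\omega(p), f|_{\omega(p)})$ is such a system. A closed set $Y \subset X$ is stable with respect to clopen sets if it has a basis of clopen positively invariant neighbourhoods, i.e. every neighbourhood of $Y$ in $X$ contains a clopen set $P \supset Y$ with $f(P) \subset P$. *)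

(* Defs.v *)
From HB Require Import structures.
From mathcomp Require Import all_boot all_order all_algebra.
From mathcomp Require Import all_classical all_reals all_analysis.

Set Implicit Arguments.
Unset Strict Implicit.
Unset Printing Implicit Defensive.

Import Order.TTheory GRing.Theory Num.Theory.

Local Open Scope classical_set_scope.
Local Open Scope ring_scope.

(* The supremum is taken in the extended reals, so that an unbounded set has
   diameter +oo; the empty set gets -oo. *)
Definition diameter (R : realType) (X : metricType R) (U : set X) : \bar R :=
  ereal_sup [set (mdist z.1 z.2)%:E | z in U `*` U].

(* The blocks are indexed by themselves; [partition] includes that they are
   nonempty. *)
Definition dynamical_partition (R : realType) (X : metricType R) (f : X -> X)
    (e : R) (P : set (set X)) : Prop :=
  [/\ finite_set P,
      partition P id [set: X],
      forall U, P U -> clopen U,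
      forall U, P U -> (diameter U < e%:E)%E &
      forall U, P U -> exists2 U', P U' & f @` U `<=` U'].

Definition omega_limit (X : topologicalType) (f : X -> X) (p : X) : set X :=
  \bigcap_N closure [set iter n f p | n in [set n | (N <= n)%N]].

Definition is_periodic_orbit (T : Type) (f : T -> T) (Y : set T) : Prop :=
  exists (q : T) (m : nat),
    [/\ (0 < m)%N, iter m f q = q & Y = range (fun n => iter n f q)].

(* Topological conjugacy of the subsystems (A, f|A) and (B, g|B); A and B carry
   their subspace topologies, and h, k matter only on A, B respectively. *)
Definition conjugate_on (T S : topologicalType) (A : set T) (f : T -> T)
    (B : set S) (g : S -> S) : Prop :=
  [/\ set_fun A A f, set_fun B B g &
      exists (h : T -> S) (k : S -> T),
        [/\ set_fun A B h /\ set_fun B A k,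
            {in A, cancel h k} /\ {in B, cancel k h},
            {within A, continuous h},
            {within B, continuous k} &
            forall x, A x -> h (f x) = g (h x)]].

Section InverseLimit.
Variables (P : nat -> finType) (tau : forall n, P n -> P n).
Variable bond : forall n, P n.+1 -> P n.
Arguments tau : clear implicits.
Arguments bond : clear implicits.

Definition discrete_prod : topologicalType :=
  prod_topology (fun n => discrete_topology (P n)).

Definition inverse_limit : set discrete_prod :=
  [set x | forall n, bond n (x n.+1) = x n].

Definition prod_map (x : discrete_prod) : discrete_prod :=
  fun n => tau n (x n).

(* Surjectivity of the bonding maps is not required: it follows from
   equivariance and the fact that each [tau n] is a single cycle. *)
Definition cyclic_inverse_sequence : Prop :=
  [/\ forall n, is_periodic_orbit (tau n) [set: P n],
      forall n x, bond n (tau n.+1 x) = tau n (bond n x) &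
      #|P n| @[n --> \oo] --> \oo].

End InverseLimit.

(* The inverse sequence is indexed from 0. *)
Definition is_adding_machine (X : topologicalType) (f : X -> X) (Y : set X) :
    Prop :=
  exists (P : nat -> finType) (tau : forall n, P n -> P n)
         (bond : forall n, P n.+1 -> P n),
    cyclic_inverse_sequence tau bond /\
    conjugate_on Y f (inverse_limit bond) (prod_map tau).

Definition clopen_stable (X : topologicalType) (f : X -> X) (Y : set X) : Prop :=
  closed Y /\
  forall V : set X, set_nbhs Y V ->
    exists Q : set X, [/\ clopen Q, Y `<=` Q, Q `<=` V & f @` Q `<=` Q].

(* Main.v *)
Require Import Defs.
From HB Require Import structures.
From mathcomp Require Import all_boot all_order all_algebra.
From mathcomp Require Import all_classical all_reals all_analysis.
From mathcomp Require Import lra.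

Set Implicit Arguments.
Unset Strict Implicit.
Unset Printing Implicit Defensive.

Import Order.TTheory GRing.Theory Num.Theory.

Local Open Scope classical_set_scope.
Local Open Scope ring_scope.

(** Both conditions are compared with the existence of colorings: maps [c] on
    an invariant set that are locally constant, such that the color of a point
    determines the color of its image, and such that points of the same color
    are [e]-close.  By compactness a dynamical partition is the same thing as a
    coloring of the whole space (the blocks are the color classes); unlike
    partitions, colorings can be restricted, paired and defined by cases without
    any bookkeeping of blocks.

    From (i) to (ii).  The color classes that meet [omega(p)] form a clopen
    positively invariant set close to [omega(p)], which gives stability.  The
    orbit of [p] returns forever to each of these classes, so [f] permutes them
    cyclically; counting from a base point of [omega(p)], a coloring amounts on
    [omega(p)] to a phase with values in Z/m ([phase_function]).  Along a
    sequence of finer and finer colorings [c_n] the periods [m_n] divide each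
    other and the phases are compatible.  If the periods are bounded, the phase
    of some [c_n] already separates points and [omega(p)] is a periodic orbit
    ([bounded_periods_periodic_orbit]); otherwise the phases identify
    [omega(p)] with the inverse limit of the cycles Z/m_n
    ([phase_adding_machine]).

    From (ii) to (i).  A periodic orbit, or an adding machine (through a
    sufficiently far coordinate), has an [e]-coloring.  Stability extends it to
    a clopen positively invariant neighbourhood [Q] of [omega(p)]
    ([coloring_extend]).  The decisive point is that the basin of [Q], the set
    of points whose orbit enters [Q], is not only open but closed: a point
    outside the basin has its omega-limit outside [Q], and stability of that
    omega-limit traps a whole neighbourhood of the point away from [Q]
    ([basin_clopen]).  By compactness the basin is then a single preimage of
    [Q], to which the coloring pulls back.  Finitely many basins cover the
    space, and as each of them is invariant together with its complement, their
    colorings can be glued ([colorable_cover]). *)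

(** * Compactness and clopen neighbourhoods *)

Section Compactness.
Context {X : topologicalType}.

(** Finite subcovers in a form without indexed families.  In the applications
    [P A] says that one bound, one number of iterations or one coloring works
    on all of [A]. *)
Lemma compact_cover_ind (K : set X) (P : set X -> Prop) :
  compact K -> P set0 ->
  (forall A B, P A -> P B -> P (A `|` B)) ->
  (forall x, K x -> exists2 U, nbhs x U & P U) ->
  exists2 A, P A & K `<=` A.
Proof.
move=> cK P0 PU Ploc; apply: contrapT => noA.
(* If no such set covers [K], the remainders of [K] generate a proper filter,
   and a cluster point of it contradicts the local hypothesis. *)
pose F : set_system X := filter_from P (fun A => K `\` A).
have FF : Filter F.
  apply: filter_from_filter; first by exists set0.
  move=> A B PA PB; exists (A `|` B); first exact: PU.
  by move=> x [Kx nAB]; split; split => // ?; apply: nAB; [left | right].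
have PF : ProperFilter F.
  apply: filter_from_proper => A PA; apply: contrapT => KA; apply: noA.
  exists A => // x Kx; apply: contrapT => nAx; apply: KA; by exists x.
have FK : F K by exists set0 => // x [].
have [x [Kx clx]] := cK F PF FK.
have [U Ux PU'] := Ploc x Kx.
have FU : F (K `\` U) by exists U.
by have [y [[_ nUy] Uy]] := clx _ _ FU Ux.
Qed.

Lemma compact_seq_cluster (K : set X) (u : nat -> X) :
  compact K -> (forall n, K (u n)) ->
  exists2 x, K x & forall U N, nbhs x U -> exists2 n, (N <= n)%N & U (u n).
Proof.
move=> cK Ku.
have FK : (u @ \oo) K by exists 0%N => // n _; exact: Ku.
have [x [Kx clx]] := cK (u @ \oo) (fmap_proper_filter _ _) FK.
exists x => // U N Ux.
have FN : (u @ \oo) (u @` [set n | (N <= n)%N]) by exists N => // n Nn; exists n.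
by have [_ [[n Nn <-] Uy]] := clx _ _ FN Ux; exists n.
Qed.

(** In a compact Hausdorff space the intersection [Q] of the clopen sets
    containing [x] is connected, so it is [x] alone; and any open set containing
    that intersection already contains one of the clopen sets. *)
Lemma totally_disconnected_clopen_nbhs (x : X) (U : set X) :
  compact [set: X] -> hausdorff_space X -> totally_disconnected [set: X] ->
  nbhs x U -> exists D, [/\ clopen D, D x & D `<=` U].
Proof.
move=> cX hX tdX Ux.
pose Q := \bigcap_(D in [set D : set X | clopen D /\ D x]) D.
have clQ : closed Q by apply: closed_bigI => D [[]].
have Qx : Q x by move=> D [].
have QD (W : set X) : open W -> Q `<=` W ->
    exists D, [/\ clopen D, D x & D `<=` W].
  move=> oW QW.
  have cW : compact (~` W).
    by apply: (subclosed_compact _ cX) => //; exact: open_closedC.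
  have [] := @compact_cover_ind _
    (fun A => exists D, [/\ clopen D, D x & D `&` A = set0]) cW.
  - by exists setT; split => //; [exact: clopenT | rewrite setI0].
  - move=> A B [D [cD Dx DA]] [E [cE Ex EB]]; exists (D `&` E).
    split => //; first exact: clopenI.
    rewrite setIUr setIAC DA set0I set0U -setIA EB setI0 //.
  - move=> y Wy.
    have /existsNP[D /not_implyP[[cD Dx] nDy]] : ~ Q y by move=> /QW.
    exists (~` D); last by exists D; split => //; exact: setICr.
    by apply: open_nbhs_nbhs; split => //; case: (clopenC D cD).
  move=> A [D [cD Dx DA]] WA; exists D; split => // y Dy.
  apply: contrapT => /WA Ay.
  by have : (D `&` A) y by []; rewrite DA.
suff Q1 : Q `<=` [set x].
  have QU : Q `<=` U° by move=> y /Q1 ->.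
  have [D [cD Dx DU]] := QD _ (open_interior _) QU.
  by exists D; split => //; apply: subset_trans DU (@interior_subset _ _).
(* A relatively clopen part [B] of [Q] and its complement in [Q] are disjoint
   closed sets.  Normality separates them by an open [V], and some clopen
   [D] around [x] misses the boundary of [V]; then [D `&` V] and its
   complement in [D] are clopen, and [Q] lies in the one that contains [x]. *)
have QC : connected Q.
  move=> B B0 [C oC BC] [E cE BE].
  have clB : closed B by rewrite BE; exact: closedI.
  have clB' : closed (Q `\` B).
    rewrite (_ : Q `\` B = Q `&` ~` C); last first.
      rewrite BC; apply/seteqP; split => y [Qy nB]; split => //.
        by move=> Cy; apply: nB.
      by move=> [_ Cy].
    by apply: closedI => //; exact: open_closedC.
  have nbB : set_nbhs B (~` (Q `\` B)).
    move=> y By; apply: open_nbhs_nbhs; split; first exact: closed_openC.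
    by move=> [].
  have [V' nV' clV'] := compact_normal hX cX clB nbB.
  have /set_nbhsP[V [oV BV VV']] := nV'.
  have clV : closure V `<=` ~` (Q `\` B).
    by apply: subset_trans clV'; exact: closureS.
  have [||D [cD Dx DW]] := QD (V `|` ~` closure V).
  - by apply: openU => //; apply: closed_openC; exact: closed_closure.
  - move=> y Qy; have [By|nBy] := pselect (B y); first by left; exact: BV.
    by right => /clV; apply.
  have cDV : clopen (D `&` V).
    split; first by apply: openI => //; case: cD.
    rewrite (_ : D `&` V = D `&` closure V).
      by apply: closedI; [case: cD | exact: closed_closure].
    apply/seteqP; split => y [Dy Vy]; split => //; first exact: subset_closure.
    by have [] := DW y Dy.
  have nV y : (Q `\` B) y -> ~ V y.
    by move=> QBy /subset_closure/clV.
  have [Bx|nBx] := pselect (B x).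
    apply/seteqP; split; first by rewrite BC => y [].
    move=> y Qy; apply: contrapT => nBy; apply: (nV y) => //.
    by have [] := Qy (D `&` V) (conj cDV (conj Dx (BV _ Bx))).
  have cDV' : clopen (D `&` ~` (D `&` V)) by apply: clopenI => //; exact: clopenC.
  have Dx' : (D `&` ~` (D `&` V)) x by split => // -[_]; exact: nV.
  have [y By] := B0.
  have Qy : Q y by move: By; rewrite BC => -[].
  have [Dy] := Qy _ (conj cDV' Dx').
  by case; split => //; exact: BV.
by rewrite -(tdX x I) => y Qy; exists Q.
Qed.
End Compactness.

(** * Colorings *)

Section Colorings.
Context {R : realType} {X : metricType R}.
Implicit Types (f : X -> X) (e : R) (A B D Q : set X).

(** The color classes play the role of the blocks of a dynamical partition of
    [A]; local constancy is relative to [A], which need not be open. *)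
Definition coloring f e A (T : Type) (c : X -> T) : Prop :=
  [/\ forall x, A x -> \forall y \near x, A y -> c y = c x,
      forall x y, A x -> A y -> c x = c y -> c (f x) = c (f y) &
      forall x y, A x -> A y -> c x = c y -> mdist x y < e].

Definition colorable f e A : Prop :=
  exists (T : Type) (c : X -> T), coloring f e A c.

Lemma coloring_clopen f e (T : Type) (c : X -> T) (S : set T) :
  coloring f e [set: X] c -> clopen (c @^-1` S).
Proof.
move=> [lc _ _].
have op S' : open (c @^-1` S').
  rewrite openE => x Sx; apply: filterS (lc x I) => y /(_ I) cyx.
  by rewrite /preimage /= cyx.
by split; rewrite // -[c @^-1` S]setCK; exact: open_closedC (op (~` S)).
Qed.

Definition invariant f A : Prop := forall x, A x -> A (f x).

Lemma invariant_iter f A n x : invariant f A -> A x -> A (iter n f x).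
Proof. by move=> fA Ax; elim: n => //= n; exact: fA. Qed.

(** The sum type keeps the colors used inside and outside [Q] distinct. *)
Definition cases Q (T1 T2 : Type) (c1 : X -> T1) (c2 : X -> T2) (x : X) :
  T1 + T2 := if `[< Q x >] then inl (c1 x) else inr (c2 x).

Lemma cases_in Q T1 T2 (c1 : X -> T1) (c2 : X -> T2) x :
  Q x -> cases Q c1 c2 x = inl (c1 x).
Proof. by move=> Qx; rewrite /cases asboolT. Qed.

Lemma cases_out Q T1 T2 (c1 : X -> T1) (c2 : X -> T2) x :
  ~ Q x -> cases Q c1 c2 x = inr (c2 x).
Proof. by move=> Qx; rewrite /cases asboolF. Qed.

(** The rule behind both pull-back and gluing.  The two colorings interact only
    through points that enter [Q], whence the combined color of the image in
    the condition on [c2]. *)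
Lemma coloring_cases f e Q D T1 T2 (c1 : X -> T1) (c2 : X -> T2) :
  clopen Q -> invariant f Q -> coloring f e Q c1 ->
  (forall x, D x -> ~ Q x -> \forall y \near x, D y -> ~ Q y -> c2 y = c2 x) ->
  (forall x y, D x -> D y -> ~ Q x -> ~ Q y -> c2 x = c2 y ->
     cases Q c1 c2 (f x) = cases Q c1 c2 (f y) /\ mdist x y < e) ->
  coloring f e D (cases Q c1 c2).
Proof.
move=> [oQ cQ] fQ [lc1 fc1 dc1] lc2 fdc2.
have casesP x y : D x -> D y -> cases Q c1 c2 x = cases Q c1 c2 y ->
    [/\ Q x, Q y & c1 x = c1 y] \/ [/\ ~ Q x, ~ Q y & c2 x = c2 y].
  move=> Dx Dy; have [Qx|Qx] := pselect (Q x); have [Qy|Qy] := pselect (Q y).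
  - by rewrite !cases_in // => -[]; left.
  - by rewrite cases_in // cases_out.
  - by rewrite cases_out // cases_in.
  - by rewrite !cases_out // => -[]; right.
split.
- move=> x Dx; have [Qx|Qx] := pselect (Q x).
    have := lc1 x Qx; apply: filterS2 (open_nbhs_nbhs (conj oQ Qx)) => y Qy + _.
    by rewrite !cases_in // => ->.
  have nQx := open_nbhs_nbhs (conj (closed_openC cQ) Qx).
  have := lc2 x Dx Qx; apply: filterS2 nQx => y Qy + Dy.
  by rewrite !cases_out // => ->.
- move=> x y Dx Dy /casesP[] // [Qx Qy c12]; last by have [] := fdc2 x y.
  by rewrite !cases_in ?(fc1 x y) //; exact: fQ.
- move=> x y Dx Dy /casesP[] // [Qx Qy c12]; first exact: dc1.
  by have [] := fdc2 x y.
Qed.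

(** A point outside [Q] that enters [Q] in one step gets the color of its image,
    which settles the dynamics, paired with a color for the identity, which
    makes the classes small. *)
Lemma colorable_preimage f e Q :
  continuous f -> clopen Q -> invariant f Q -> colorable id e [set: X] ->
  colorable f e Q -> colorable f e (f @^-1` Q).
Proof.
move=> fc cQ fQ [S [d [ld _ sd]]] [T [c cc]].
exists (T + (S * T))%type, (cases Q c (fun x => (d x, c (f x)))).
have [lc _ _] := cc.
apply: coloring_cases => //.
  move=> x Qfx _; have := fc x _ (lc _ Qfx).
  have := ld x I; apply: filterS2 => y /= dyx cyx Qfy _.
  by rewrite dyx // cyx.
move=> x y Qfx Qfy _ _ [dxy cxy]; split; last exact: sd.
by rewrite !cases_in // cxy.
Qed.

(** The equivalence [A (f x) <-> A x] is essential: points of [B] outside [A]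
    never enter [A], so the colors of [B] may be used there. *)
Lemma colorable_setU f e A B :
  clopen A -> (forall x, A (f x) <-> A x) -> invariant f B ->
  colorable f e A -> colorable f e B -> colorable f e (A `|` B).
Proof.
move=> cA fA fB [S [a ca]] [T [b [lb fb sb]]].
exists (S + T)%type, (cases A a b).
apply: coloring_cases => //; first by move=> x /fA.
  move=> x [//|Bx] _; apply: filterS (lb x Bx) => y byx [//|By] _; exact: byx.
move=> x y [//|Bx] [//|By] nAx nAy bxy; split; last exact: sb.
by rewrite !cases_out ?(fb x y) // => /fA.
Qed.

Lemma colorable_cover f e : compact [set: X] ->
  (forall x, exists A, [/\ A x, clopen A, (forall y, A (f y) <-> A y) &
     colorable f e A]) ->
  colorable f e [set: X].
Proof.
move=> cX locA.
have [] := @compact_cover_ind _ [set: X]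
  (fun A => [/\ clopen A, forall y, A (f y) <-> A y & colorable f e A]) cX.
- by split; [exact: clopen0 | | exists unit, (fun=> tt)].
- move=> A B [cA fA colA] [cB fB colB]; split.
  + exact: clopenU.
  + by move=> y; split => -[/fA|/fB]; by [left | right].
  + by apply: colorable_setU => // x /fB.
- move=> x _; have [A [Ax cA fA colA]] := locA x; exists A => //.
  by apply: open_nbhs_nbhs; split => //; case: cA.
move=> A [_ _ colA] TA.
by rewrite (_ : [set: X] = A) //; apply/seteqP; split.
Qed.

(** For the identity every clopen set is invariant together with its complement,
    so small clopen neighbourhoods, each of one color, can be glued. *)
Lemma colorable_id e :
  compact [set: X] -> totally_disconnected [set: X] -> 0 < e ->
  colorable id e [set: X].
Proof.
move=> cX tdX e0; apply: colorable_cover => // x.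
have e20 : 0 < e / 2 by rewrite divr_gt0.
have [D [cD Dx DU]] := totally_disconnected_clopen_nbhs cX
  (@metric_hausdorff _ X) tdX (nbhsx_ballx x _ e20).
exists D; split => //; exists unit, (fun=> tt); split => //.
  by move=> y _; near=> z.
move=> y z /DU + /DU + _; rewrite !ballEmdist /= => xy xz.
rewrite (le_lt_trans (metric_triangle y x z)) // (metric_sym y).
by rewrite [e]splitr ltrD.
Unshelve. all: by end_near. Qed.

(** * Omega-limits and basins *)

Lemma iter_continuous f n : continuous f -> continuous (iter n f).
Proof.
move=> fc; elim: n => [|n IH] x; first exact: cvg_id.
exact: (continuous_comp (IH x) (fc _)).
Qed.

Lemma open_near_iter f n x U : continuous f -> open U -> U (iter n f x) ->
  \forall y \near x, U (iter n f y).
Proof.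
move=> fc oU Ux; apply: (@iter_continuous f n fc x).
exact: open_nbhs_nbhs.
Qed.

Lemma omega_limitP f p x : omega_limit f p x <->
  forall U N, nbhs x U -> exists2 n, (N <= n)%N & U (iter n f p).
Proof.
split=> [ox U N Ux|ox N _ U Ux].
  by have [_ [[n Nn <-] Un]] := ox N I U Ux; exists n.
have [n Nn Un] := ox U N Ux.
by exists (iter n f p); split => //; exists n.
Qed.

Lemma omega_limit_nonempty f p : compact [set: X] -> omega_limit f p !=set0.
Proof.
move=> cX; have [//|x _ ux] := @compact_seq_cluster _ _ (fun n => iter n f p) cX.
by exists x; apply/omega_limitP.
Qed.

Lemma omega_limit_invariant f p : continuous f -> invariant f (omega_limit f p).
Proof.
move=> fc x /omega_limitP ox; apply/omega_limitP => U N Ufx.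
have [n Nn Un] := ox (f @^-1` U) N (fc x _ Ufx).
by exists n.+1; rewrite ?leqW.
Qed.

Lemma omega_limit_closed f p : closed (omega_limit f p).
Proof. by apply: closed_bigI => N _; exact: closed_closure. Qed.

Definition basin f Q : set X := [set x | exists n, Q (iter n f x)].

(** The key point of the implication from (ii) to (i).  If [x] is outside the
    basin, its omega-limit avoids [Q], hence has a clopen invariant
    neighbourhood [Q'] disjoint from [Q].  Orbits of points near [x] enter [Q']
    at the same time as that of [x] and stay there, so they never meet [Q]:
    a visit to [Q] would be permanent. *)
Lemma basin_clopen f Q : compact [set: X] -> continuous f ->
  (forall p, clopen_stable f (omega_limit f p)) ->
  clopen Q -> invariant f Q -> clopen (basin f Q).
Proof.
move=> cX fc stab [oQ cQ] fQ; split.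
  rewrite openE => x [n Qn]; apply: filterS (open_near_iter fc oQ Qn).
  by move=> y Qy; exists n.
rewrite -[basin f Q]setCK; apply: open_closedC; rewrite openE => x nBx.
have oxQ : omega_limit f x `<=` ~` Q.
  move=> y /omega_limitP oy Qy.
  have [n _ Qn] := oy Q 0%N (open_nbhs_nbhs (conj oQ Qy)).
  by apply: nBx; exists n.
have [_ /(_ (~` Q))[]] := stab x.
  by move=> y /oxQ nQy; apply: open_nbhs_nbhs; split => //; exact: closed_openC.
move=> Q' [[oQ' _] oxQ' Q'Q fQ'].
have [y oy] := omega_limit_nonempty f x cX.
have /omega_limitP/(_ Q' 0%N)[|n _ Q'n] := oy.
  by apply: open_nbhs_nbhs; split => //; exact: oxQ'.
apply: filterS (open_near_iter fc oQ' Q'n) => z Q'z.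
move=> [m Qm].
have fQ'i : invariant f Q' by move=> w Q'w; apply: fQ'; exists w.
apply: (Q'Q (iter m f (iter n f z))); first exact: invariant_iter.
by rewrite -iterD addnC iterD; exact: invariant_iter.
Qed.

Lemma basin_invariant f Q x : invariant f Q ->
  basin f Q (f x) <-> basin f Q x.
Proof.
move=> fQ; split=> -[n Qn]; first by exists n.+1; rewrite iterSr.
by exists n; rewrite -iterSr; exact: fQ.
Qed.

(** The preimages of [Q] increase with the number of iterations and cover the
    basin, which is compact. *)
Lemma basin_uniform f Q : compact [set: X] -> continuous f ->
  clopen Q -> invariant f Q -> clopen (basin f Q) ->
  exists n, basin f Q = iter n f @^-1` Q.
Proof.
move=> cX fc [oQ cQ] fQ [_ cB].
have cB' : compact (basin f Q) by exact: subclosed_compact cX _.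
have mono m n x : (m <= n)%N -> Q (iter m f x) -> Q (iter n f x).
  by move=> /subnK <- Qm; rewrite iterD; exact: invariant_iter.
have [] := @compact_cover_ind _ _
  (fun A => exists n, A `<=` iter n f @^-1` Q) cB'.
- by exists 0%N.
- move=> A B [m mA] [n nB]; exists (maxn m n) => x [/mA|/nB]; apply: mono.
    exact: leq_maxl.
  exact: leq_maxr.
- move=> x [n Qn]; exists (iter n f @^-1` Q); last by exists n.
  exact: (open_near_iter fc oQ Qn).
move=> A [n An] BA; exists n; apply/seteqP; split; first exact: subset_trans An.
by move=> x Qx; exists n.
Qed.

Lemma colorable_basin f e Q : compact [set: X] ->
  totally_disconnected [set: X] -> continuous f ->
  (forall p, clopen_stable f (omega_limit f p)) -> 0 < e ->
  clopen Q -> invariant f Q -> colorable f e Q -> colorable f e (basin f Q).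
Proof.
move=> cX tdX fc stab e0 cQ fQ colQ.
have cB := basin_clopen cX fc stab cQ fQ.
have [n ->] := basin_uniform cX fc cQ fQ cB.
have: [/\ clopen (iter n f @^-1` Q), invariant f (iter n f @^-1` Q) &
    colorable f e (iter n f @^-1` Q)]; last by case.
elim: n => [|n [cQn fQn colQn]]; first by split.
have -> : iter n.+1 f @^-1` Q = f @^-1` (iter n f @^-1` Q).
  by apply/seteqP; split => x; rewrite /preimage /= -iterSr.
split.
- exact: preimage_clopen.
- by move=> x; exact: fQn.
- by apply: colorable_preimage => //; exact: colorable_id.
Qed.

(** * From a coloring of an omega-limit to a coloring of a neighbourhood *)

Lemma lebesgue_number (Y : set X) (T : Type) (c : X -> T) :
  compact Y -> (forall x, Y x -> \forall y \near x, Y y -> c y = c x) ->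
  exists2 d : R, 0 < d &
    forall x y, Y x -> Y y -> mdist x y < d -> c x = c y.
Proof.
move=> cY lc.
have [] := @compact_cover_ind _ Y (fun A => exists2 d : R, 0 < d &
  forall x y, A x -> Y x -> Y y -> mdist x y < d -> c x = c y) cY.
- by exists 1.
- move=> A B [a a0 aA] [b b0 bB]; exists (Num.min a b); first by rewrite lt_min a0.
  by move=> x y + Yx Yy; rewrite lt_min => -[Ax|Bx] /andP[xa xb]; [exact: aA | exact: bB].
- move=> x Yx; have /nbhs_ballP[r /= r0 rc] := lc x Yx.
  have r20 : 0 < r / 2 by rewrite divr_gt0.
  exists (ball x (r / 2)); first exact: nbhsx_ballx.
  exists (r / 2) => // y z; rewrite ballEmdist /= => xy Yy Yz yz.
  rewrite !(rc _ _ _) // ballEmdist /=.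
    by rewrite (le_lt_trans (metric_triangle x y z)) // [r]splitr ltrD.
  by rewrite (lt_trans xy) // ltr_pdivrMr // ltr_pMr // ltr1n.
move=> A [d d0 dA] YA; exists d => // x y Yx; apply: dA => //; exact: YA.
Qed.

(** A point near [Y] gets the color of a nearby point of [Y], which is
    unambiguous below the Lebesgue number of [c].  The dynamics is respected
    where [z] and [f z] are close to [y] and [f y] for one and the same point
    [y] of [Y]; this set [G] is a neighbourhood of [Y], and stability provides
    an invariant clopen set inside it. *)
Lemma coloring_extend f e (Y : set X) (T : Type) (c : X -> T) :
  compact Y -> continuous f -> 0 < e -> invariant f Y -> clopen_stable f Y ->
  coloring f (e / 3) Y c ->
  exists Q, [/\ clopen Q, Y `<=` Q, invariant f Q & colorable f e Q].
Proof.
move=> cY fc e0 fY [_ stab] [lc cf cs].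
(* Two points of [Y] that are [r]-close to the same point have the same color,
   and a chain of distances [r], [e / 3], [r] stays below [e]. *)
have [d d0 dc] := lebesgue_number cY lc.
pose r := Num.min (d / 2) (e / 3).
have r0 : 0 < r by rewrite lt_min !divr_gt0.
have rd : r + r <= d by rewrite [d]splitr lerD // ge_min lexx.
have re : r + e / 3 + r <= e.
  have : r <= e / 3 by rewrite ge_min lexx orbT.
  lra.
pose C z := c (xget z [set y | Y y /\ mdist z y < r]).
have Cc z y : Y y -> mdist z y < r -> C z = c y.
  move=> Yy zy; rewrite /C; case: xgetP => [y' _ [Yy' zy']|/(_ y)[]//].
  apply: dc => //; apply: lt_le_trans rd.
  rewrite (le_lt_trans (metric_triangle y' z y)) // (metric_sym y').
  by rewrite ltrD.
pose G : set X := [set z | exists y, [/\ Y y, mdist z y < r & mdist (f z) (f y) < r]].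
have nbG : set_nbhs Y G.
  move=> y Yy; near=> z; exists y; split => //.
    have : ball y r z by near: z; exact: nbhsx_ballx.
    by rewrite ballEmdist /= metric_sym.
  have : ball (f y) r (f z) by near: z; apply: (fc y); exact: nbhsx_ballx.
  by rewrite ballEmdist /= metric_sym.
have [Q [cQ YQ QG fQ]] := stab G nbG.
exists Q; split => //; first by move=> z Qz; apply: fQ; exists z.
exists T, C; split.
- move=> z /QG[y [Yy zy _]].
  have rz : 0 < r - mdist z y by rewrite subr_gt0.
  apply: filterS (nbhsx_ballx z _ rz) => z'; rewrite ballEmdist /= => zz' _.
  have z'y : mdist z' y < r.
    rewrite (le_lt_trans (metric_triangle z' z y)) // (metric_sym z').
    by rewrite -ltrBrDr.
  by rewrite !(Cc _ y).
- move=> z z' /QG[y [Yy zy fzy]] /QG[y' [Yy' zy' fzy']].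
  rewrite (Cc z y) // (Cc z' y') // => cyy'.
  by rewrite (Cc (f z) (f y)) ?(Cc (f z') (f y')) //; [exact: cf | exact: fY..].
- move=> z z' /QG[y [Yy zy _]] /QG[y' [Yy' zy' _]].
  rewrite (Cc z y) // (Cc z' y') // => cyy'; have yy' := cs _ _ Yy Yy' cyy'.
  apply: lt_le_trans re; rewrite (le_lt_trans (metric_triangle z y' z')) //.
  rewrite ltrD //; last by rewrite metric_sym.
  by rewrite (le_lt_trans (metric_triangle z y y')) // ltrD.
Unshelve. all: by end_near. Qed.
End Colorings.

(** * Colorings of periodic orbits and adding machines *)

Section AttractorColorings.
Context {R : realType} {X : metricType R}.
Implicit Types (f : X -> X) (e : R) (Y : set X).

Lemma iter_modn (T : Type) (g : T -> T) (q : T) m n :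
  iter m g q = q -> iter (n %% m) g q = iter n g q.
Proof.
move=> gq; rewrite [in RHS](divn_eq n m) addnC iterD; congr iter.
by elim: (n %/ m)%N => //= k IH; rewrite mulSn iterD -IH.
Qed.

(** A periodic orbit is finite, hence discrete, and each of its points can be its
    own color. *)
Lemma periodic_orbit_coloring f e Y :
  0 < e -> is_periodic_orbit f Y -> coloring f e Y id.
Proof.
move=> e0 [q [m [m0 fq ->]]].
have -> : range (fun n => iter n f q) = (fun n => iter n f q) @` `I_m.
  apply/seteqP; split => _ [n nm <-]; last by exists n.
  by exists (n %% m)%N; [exact: ltn_pmod | exact: iter_modn].
have finY : finite_set ((fun n => iter n f q) @` `I_m).
  exact/finite_image/finite_II.
split=> [x Yx|x y _ _ ->//|x y _ _ ->]; last by rewrite mdistxx.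
have clYx : closed ((fun n => iter n f q) @` `I_m `\ x).
  apply: (accessible_finite_set_closed.1 _ _ (finite_setD _ finY)).
  exact/hausdorff_accessible/metric_hausdorff.
have : \forall y \near x, (~` ((fun n => iter n f q) @` `I_m `\ x)) y.
  by apply: open_nbhs_nbhs; split; [exact: closed_openC | move=> [_]; apply].
apply: filterS => y nYy Yy; apply: contrapT => yx; exact: nYy.
Qed.

Lemma inverse_limit_eq_leq (P : nat -> finType)
    (bond : forall n, P n.+1 -> P n) (s t : discrete_prod P) m n :
  inverse_limit bond s -> inverse_limit bond t -> (m <= n)%N ->
  s n = t n -> s m = t m.
Proof.
move=> Bs Bt /subnK <-; elim: (n - m)%N => // k IH.
by rewrite addSn => st; apply: IH; rewrite -(Bs (k + m)%N) st Bt.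
Qed.

(** The color is the coordinate of some large index [n].  Coordinates separate
    points, later ones determine earlier ones, and [Y `*` Y] is compact, so one
    coordinate suffices to make all classes small. *)
Lemma adding_machine_colorable f e Y :
  compact Y -> 0 < e -> is_adding_machine f Y -> colorable f e Y.
Proof.
move=> cY e0 [P [tau [bond [_ [_ _ [h [k [[hY _] [hk _] hc _ hf]]]]]]]].
have lc n x : Y x -> \forall y \near x, Y y -> h y n = h x n.
  move=> Yx; have hx := (subspace_continuousP Y h).1 hc x Yx.
  have hn : nbhs (h x) [set t | t n = h x n].
    exact: (@proj_continuous _ (fun n => discrete_topology (P n)) n (h x) _
      (discrete_set1 (h x n))).
  exact: hx hn.
have [] := @compact_cover_ind _ (Y `*` Y) (fun A => exists n, forall z,
  A z -> Y z.1 -> Y z.2 -> h z.1 n = h z.2 n -> mdist z.1 z.2 < e)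
  (compact_setX cY cY).
- by exists 0%N.
- move=> A B [m mA] [n nB]; exists (maxn m n) => z ABz Y1 Y2 hz.
  have hle i : (i <= maxn m n)%N -> h z.1 i = h z.2 i.
    move=> im; exact: inverse_limit_eq_leq (hY _ Y1) (hY _ Y2) im hz.
  case: ABz => [Az|Bz].
    by apply: mA => //; apply/hle/leq_maxl.
  by apply: nB => //; apply/hle/leq_maxr.
- move=> [x y] [/= Yx Yy]; have [->|xy] := pselect (x = y).
    have e20 : 0 < e / 2 by rewrite divr_gt0.
    exists (ball y (e / 2) `*` ball y (e / 2)).
      by exists (ball y (e / 2), ball y (e / 2)) => //; split; exact: nbhsx_ballx.
    exists 0%N => z []; rewrite !ballEmdist /= => yz1 yz2 _ _ _.
    rewrite (le_lt_trans (metric_triangle _ y _)) // metric_sym.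
    by rewrite [e]splitr ltrD.
  have [n hn] : exists n, h x n <> h y n.
    apply/existsNP => hxy; apply: xy.
    rewrite -(hk x) ?inE // -(hk y) ?inE //; congr k.
    exact: functional_extensionality_dep.
  exists ([set x' | Y x' -> h x' n = h x n] `*` [set y' | Y y' -> h y' n = h y n]).
    by exists ([set x' | Y x' -> h x' n = h x n],
      [set y' | Y y' -> h y' n = h y n]) => //; split; exact: lc.
  by exists n => z [/= hx hy] /hx -> /hy ->.
move=> A [n An] YA; exists (P n), (fun x => h x n); split.
- exact: lc.
- by move=> x y Yx Yy hxy; rewrite !hf // /prod_map hxy.
- by move=> x y Yx Yy; apply: (An (x, y)) => //; exact: YA.
Qed.

(** * Gluing the basins *)

Lemma colorable_of_omega_limits f e :
  compact [set: X] -> totally_disconnected [set: X] -> continuous f ->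
  (forall p : X,
     (is_periodic_orbit f (omega_limit f p) \/
      is_adding_machine f (omega_limit f p)) /\
     clopen_stable f (omega_limit f p)) ->
  0 < e -> colorable f e [set: X].
Proof.
move=> cX tdX fc om e0; have stab p := (om p).2.
have e30 : 0 < e / 3 by rewrite divr_gt0.
apply: colorable_cover => // p.
have cO : compact (omega_limit f p).
  by apply: subclosed_compact cX _ => //; exact: omega_limit_closed.
have [T [c cc]] : colorable f (e / 3) (omega_limit f p).
  have [[per|add] _] := om p; last exact: adding_machine_colorable.
  by exists X, id; exact: periodic_orbit_coloring.
have [Q [cQ OQ fQ colQ]] := coloring_extend cO fc e0
  (omega_limit_invariant fc) (stab p) cc.
exists (basin f Q); split.
- have [y Oy] := omega_limit_nonempty f p cX.
  have /omega_limitP/(_ Q 0%N)[|n _ Qn] := Oy; last by exists n.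
  by apply: open_nbhs_nbhs; split; [case: cQ | exact: OQ].
- exact: basin_clopen.
- by move=> y; exact: basin_invariant.
- exact: colorable_basin.
Qed.

(** * Colorings and dynamical partitions *)

(** The factor [2] absorbs the passage from distances below [e] to a diameter
    below [e]. *)
Lemma colorable_dynamical_partition f e :
  compact [set: X] -> 0 < e -> colorable f (e / 2) [set: X] ->
  exists P, dynamical_partition f e P.
Proof.
move=> cX e0 [T [c cc]]; have [_ fc sc] := cc.
pose cls x := [set y | c y = c x].
have clsE x y : c x = c y -> cls x = cls y by rewrite /cls => ->.
have cl x : clopen (cls x) by exact: (coloring_clopen [set c x] cc).
exists (range cls); split.
- have [] := @compact_cover_ind _ [set: X] (fun A => finite_set (cls @` A)) cX.
  + by rewrite image_set0.
  + by move=> A B fA fB; rewrite image_setU finite_setU.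
  + move=> x _; exists (cls x).
      by apply: open_nbhs_nbhs; split => //; by case: (cl x).
    apply: (@sub_finite_set _ _ [set cls x]) => //.
    by move=> _ [y cyx <-]; exact: clsE.
  by move=> A fA TA; apply: sub_finite_set fA; exact: image_subset.
- split.
  + by apply/seteqP; split => // x _; exists (cls x) => //; exists x.
  + by move=> _ _ [x _ <-] [y _ <-] [z [zx zy]]; apply: clsE; rewrite -zx.
  + by move=> _ [x _ <-]; exists x.
- by move=> _ [x _ <-].
- move=> _ [x _ <-]; apply: (@le_lt_trans _ _ (e / 2)%:E).
    apply: ge_ereal_sup => _ [[y z] [/= yx zx] <-]; rewrite lee_fin ltW //.
    by apply: sc => //=; rewrite yx.
  by rewrite lte_fin ltr_pdivrMr // ltr_pMr // ltr1n.
- move=> _ [x _ <-]; exists (cls (f x)); first by exists (f x).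
  by move=> _ [y yx <-]; exact: fc.
Qed.

Lemma dynamical_partition_colorable f e P :
  dynamical_partition f e P -> exists c : X -> set X, coloring f e [set: X] c.
Proof.
move=> [_ [cover triv _] cl diam fP].
have blk x : exists U, P U /\ U x.
  have [U PU Ux] : (classical_sets.cover P id) x by rewrite cover.
  by exists U.
have [c cP] := choice blk.
have cE x U : P U -> U x -> c x = U.
  by move=> PU Ux; apply: triv => //; [exact: (cP x).1 | exists x; split => //; exact: (cP x).2].
exists c; split.
- move=> x _; have [Pcx cx] := cP x.
  apply: filterS (open_nbhs_nbhs (conj (cl _ Pcx).1 cx)) => y cxy _.
  exact: cE.
- move=> x y _ _ cxy; have [U PU fU] := fP _ (cP x).1.
  rewrite (cE (f x) U) // ?(cE (f y) U) //; apply: fU.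
    by exists y => //; rewrite cxy; exact: (cP y).2.
  by exists x => //; exact: (cP x).2.
- move=> x y _ _ cxy; rewrite -lte_fin; apply: le_lt_trans (diam _ (cP x).1).
  apply: ereal_sup_ubound; exists (x, y) => //; split; first exact: (cP x).2.
  by rewrite /= cxy; exact: (cP y).2.
Qed.
End AttractorColorings.

(** * Stability and phases of an omega-limit *)

Section Odometer.
Context {R : realType} {X : metricType R}.
Implicit Types (f : X -> X) (e : R) (Y : set X).

Lemma coloring_iter f e A (T : Type) (c : X -> T) k x y :
  coloring f e A c -> invariant f A -> A x -> A y -> c x = c y ->
  c (iter k f x) = c (iter k f y).
Proof.
move=> [_ cf _] fA Ax Ay cxy; elim: k => //= k IH.
by apply: cf => //; exact: invariant_iter.
Qed.

(** The orbit of [p] visits the class of [x] and later that of [y]; the delay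
    between the two visits works for [x] itself, as colors evolve
    autonomously. *)
Lemma omega_limit_transitive f e p (T : Type) (c : X -> T) x y :
  coloring f e [set: X] c -> omega_limit f p x -> omega_limit f p y ->
  exists2 k, (0 < k)%N & c (iter k f x) = c y.
Proof.
move=> cc /omega_limitP ox /omega_limitP oy; have [lc _ _] := cc.
have cls z : nbhs z [set z' | c z' = c z].
  by apply: filterS (lc z I) => z'; exact.
have [i _ ci] := ox _ 0%N (cls x); have [j ij cj] := oy _ i.+1 (cls y).
exists (j - i)%N; first by rewrite subn_gt0.
rewrite -cj /= -[in RHS](subnK (ltnW ij)) iterD.
by apply: coloring_iter cc _ _ _ _ => //.
Qed.

(** The union of the color classes that meet the omega-limit is clopen,
    invariant, and as close to the omega-limit as the classes are small. *)
Lemma colorable_clopen_stable f p : compact [set: X] -> continuous f ->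
  (forall e, 0 < e -> colorable f e [set: X]) ->
  clopen_stable f (omega_limit f p).
Proof.
move=> cX fc col; split; first exact: omega_limit_closed.
move=> V nV.
have cO : compact (omega_limit f p).
  by apply: (subclosed_compact _ cX) => //; exact: omega_limit_closed.
have [] := @compact_cover_ind _ (omega_limit f p) (fun A =>
  exists2 d : R, 0 < d & forall x y, A x -> mdist x y < d -> V y) cO.
- by exists 1.
- move=> A B [a a0 aA] [b b0 bB]; exists (Num.min a b); first by rewrite lt_min a0.
  move=> x y ABx; rewrite lt_min => /andP[xa xb].
  by case: ABx => [Ax|Bx]; [exact: aA xa | exact: bB xb].
- move=> x Ox; have /nbhs_ballP[r /= r0 rV] := nV x Ox.
  have r20 : 0 < r / 2 by rewrite divr_gt0.
  exists (ball x (r / 2)); first exact: nbhsx_ballx.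
  exists (r / 2) => // y z; rewrite ballEmdist /= => xy yz.
  apply: rV; rewrite ballEmdist /=.
  by rewrite (le_lt_trans (metric_triangle x y z)) // [r]splitr ltrD.
move=> A [d d0 dV] OA; have [T [c cc]] := col d d0; have [_ cf cs] := cc.
exists (c @^-1` (c @` omega_limit f p)); split.
- exact: coloring_clopen cc.
- by move=> x Ox; exists x.
- by move=> z [x Ox xz]; apply: (dV x); [exact: OA | exact: cs].
- move=> _ [z [x Ox xz] <-]; exists (f x); first exact: omega_limit_invariant.
  exact: cf.
Qed.

(** The colors of the orbit of [x0] are periodic from the start and exhaust those
    of [Y]; [m] is the least period and [theta x] a time at which the orbit
    shows the color of [x], so it is meaningful modulo [m] only. *)
Lemma phase_function f Y (T : Type) (c : X -> T) (x0 : X) :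
  invariant f Y -> Y x0 ->
  (forall x y, Y x -> Y y -> c x = c y -> c (f x) = c (f y)) ->
  (forall x y, Y x -> Y y -> exists2 k, (0 < k)%N & c (iter k f x) = c y) ->
  exists (m : nat) (theta : X -> nat), (0 < m)%N /\
    forall x k, Y x -> c (iter k f x0) = c x <-> k = theta x %[mod m].
Proof.
move=> fY Yx0 cf tr.
have Yi k : Y (iter k f x0) by exact: invariant_iter.
have ci k x y : Y x -> Y y -> c x = c y -> c (iter k f x) = c (iter k f y).
  move=> Yx Yy cxy; elim: k => //= k IH.
  by apply: cf => //; exact: invariant_iter.
have exm : exists k, (0 < k)%N && `[< c (iter k f x0) = c x0 >].
  by have [k k0 ck] := tr _ _ Yx0 Yx0; exists k; rewrite k0 asboolT.
case: (ex_minnP exm) => m /andP[m0 /asboolP cm] minm.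
have per q : c (iter (q * m) f x0) = c x0.
  elim: q => //= q IH; rewrite mulSn iterD -[RHS]cm.
  by apply: ci => //; exact: Yi.
have cmod i : c (iter i f x0) = c (iter (i %% m) f x0).
  by rewrite [in LHS](divn_eq i m) addnC iterD; apply: ci.
(* A coincidence of colors at times [a < b < m] would bring the color of [x0]
   back at time [m - b + a], before the least period. *)
have inj a b : (a < b)%N -> (b < m)%N -> c (iter a f x0) <> c (iter b f x0).
  move=> ab bm cab.
  have : (m <= m - b + a)%N.
    apply: minm; rewrite addn_gt0 subn_gt0 bm /=; apply/asboolP.
    rewrite iterD (ci _ _ (iter b f x0)) // -iterD subnK //; exact: ltnW.
  by rewrite leqNgt -ltn_subRL subKn ?ab // ltnW.
have cP i j : c (iter i f x0) = c (iter j f x0) <-> i = j %[mod m].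
  split=> [|ij]; last by rewrite cmod ij -cmod.
  rewrite cmod [c (iter j f x0)]cmod => cij.
  have [im jm] := (ltn_pmod i m0, ltn_pmod j m0).
  by have [/inj-/(_ jm)|/inj-/(_ im) /(_ (esym cij))|] := ltngtP (i %% m) (j %% m).
have reach x : exists k, Y x -> c (iter k f x0) = c x.
  have [Yx|nYx] := pselect (Y x); last by exists 0%N.
  by have [k _ ck] := tr _ _ Yx0 Yx; exists k.
have [theta thetaP] := choice reach.
by exists m, theta; split => // x k Yx; rewrite -(thetaP _ Yx).
Qed.

(** The [n]-th coloring records the colors of all of the first [n + 1] given ones.
    It does so in a function of the index, constant beyond [n], so that all the
    [c n] share one type of colors. *)
Lemma refining_colorings f :
  (forall e, 0 < e -> exists c : X -> set X, coloring f e [set: X] c) ->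
  exists c : nat -> X -> nat -> set X,
    (forall n, coloring f n.+1%:R^-1 [set: X] (c n)) /\
    (forall m n x y, (m <= n)%N -> c n x = c n y -> c m x = c m y).
Proof.
move=> col.
have [b bP] := choice (fun n : nat =>
  col n.+1%:R^-1 (ltac:(by rewrite invr_gt0) : 0 < n.+1%:R^-1 :> R)).
pose c n x i := if (i <= n)%N then b i x else set0.
have cE n x y : c n x = c n y <-> forall i, (i <= n)%N -> b i x = b i y.
  split=> [cxy i ni|bxy].
    by have := congr1 (fun g => g i) cxy; rewrite /c ni.
  by apply/funext => i; rewrite /c; case: ifPn => // /bxy.
exists c; split; last first.
  by move=> m n x y mn /cE bxy; apply/cE => i im; apply: bxy; exact: leq_trans mn.
move=> n; split.
- move=> x _; suff: \forall y \near x, forall i, (i <= n)%N -> b i y = b i x.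
    by apply: filterS => y bxy _; exact/cE.
  elim: n => [|n IH].
    have [lb _ _] := bP 0%N; apply: filterS (lb x I) => y bxy i.
    by rewrite leqn0 => /eqP ->; exact: bxy.
  have [lb _ _] := bP n.+1; apply: filterS2 IH (lb x I) => y bxy byx i.
  by rewrite leq_eqVlt => /orP[/eqP ->|]; [exact: byx | exact: bxy].
- by move=> x y _ _ /cE bxy; apply/cE => i /bxy; have [_ fb _] := bP i; exact: fb.
- by move=> x y _ _ /cE/(_ n (leqnn n)); have [_ _ sb] := bP n; exact: sb.
Qed.
End Odometer.

(** * Compatible phases: periodic orbit or adding machine *)

Section PhaseSystem.
Context {R : realType} {X : metricType R}.
Context (f : X -> X) (Y : set X) (x0 : X).
Context (fY : invariant f Y) (Yx0 : Y x0).
Context (T : Type) (c : nat -> X -> T) (m : nat -> nat) (theta : nat -> X -> nat).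
Context (cc : forall n, coloring f (n.+1%:R^-1 : R) [set: X] (c n)).
Context (cref : forall i n x y, (i <= n)%N -> c n x = c n y -> c i x = c i y).
Context (m0 : forall n, (0 < m n)%N).
Context (thetaP : forall n x k, Y x ->
  c n (iter k f x0) = c n x <-> k = theta n x %[mod m n]).

Let Yiter k : Y (iter k f x0). Proof. exact: invariant_iter. Qed.

Lemma color_theta n x : Y x -> c n (iter (theta n x) f x0) = c n x.
Proof. by move=> Yx; apply/thetaP. Qed.

Lemma theta_inj n x y : Y x -> Y y ->
  c n x = c n y <-> theta n x = theta n y %[mod m n].
Proof. by move=> Yx Yy; rewrite -thetaP // color_theta. Qed.

Lemma theta_step n x : Y x -> theta n (f x) = (theta n x).+1 %[mod m n].
Proof.
move=> Yx; apply/esym/thetaP; first exact: fY.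
have [_ cf _] := cc n.
by rewrite /= (cf _ x) //; exact: color_theta.
Qed.

Lemma theta_refine i n x : (i <= n)%N -> Y x -> theta n x = theta i x %[mod m i].
Proof.
by move=> le_in Yx; apply/thetaP => //; apply: cref le_in _; exact: color_theta.
Qed.

Lemma theta_base n : theta n x0 = 0 %[mod m n].
Proof. exact/esym/thetaP. Qed.

(** The finer color of [x0] recurs at time [m n], and so does the coarser
    one. *)
Lemma period_dvdn i n : (i <= n)%N -> (m i %| m n)%N.
Proof.
move=> le_in.
have cm : c n (iter (m n) f x0) = c n x0.
  by apply/thetaP; rewrite // theta_base modnn mod0n.
by rewrite /dvdn -(mod0n (m i)) -(theta_base i); apply/eqP/thetaP => //; exact: cref cm.
Qed.

Lemma same_colors_eq N x y : (forall n, (N <= n)%N -> c n x = c n y) -> x = y.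
Proof.
move=> cxy; apply: mdist_positivity; apply/eqP; rewrite eq_le mdist_ge0 andbT.
apply/ler_addgt0Pr => e e0; rewrite add0r.
have [n _ ne] : \forall n \near \oo, (n.+1%:R^-1 : R) < e.
  exact: near_infty_natSinv_lt (PosNum e0).
have Nn := leq_maxl N n; have [_ _ sc] := cc (maxn N n).
apply/ltW/(lt_trans (sc x y I I (cxy _ Nn))); apply: ne => /=; exact: leq_maxr.
Qed.

(** The periods are eventually constant; from then on equal phases at one level
    are equal phases at all finer levels, so the phase separates points. *)
Lemma bounded_periods_periodic_orbit :
  (exists B, forall n, (m n <= B)%N) -> is_periodic_orbit f Y.
Proof.
move=> [B mB].
have [v /asboolP[N <-] maxv] := @ex_maxnP (fun v => `[< exists n, m n = v >]) B
  (ex_intro _ (m 0%N) (asboolT (ex_intro _ 0%N erefl)))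
  (fun v => ltac:(by move=> /asboolP[n <-])).
have mN n : (N <= n)%N -> m n = m N.
  move=> Nn; apply/eqP; rewrite eqn_leq (dvdn_leq _ (period_dvdn Nn)) ?m0 // andbT.
  by apply: maxv; apply/asboolP; exists n.
have injN x y : Y x -> Y y -> c N x = c N y -> x = y.
  move=> Yx Yy /theta_inj-/(_ Yx Yy) txy; apply: (@same_colors_eq N) => n Nn.
  by apply/theta_inj => //; rewrite mN // !theta_refine.
exists x0, (m N); split => //.
  apply: injN => //; apply/thetaP => //.
  by rewrite theta_base modnn mod0n.
apply/seteqP; split=> [x Yx|_ [n _ <-] //].
by exists (theta N x) => //; apply: injN => //; exact: color_theta.
Qed.

Let P n : finType := 'I_(m n).
Let tau n (i : P n) : P n := Ordinal (ltn_pmod i.+1 (m0 n)).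
Let bond n (i : P n.+1) : P n := Ordinal (ltn_pmod i (m0 n)).

Lemma cyclic_phases :
  (forall B, exists n, (B < m n)%N) -> cyclic_inverse_sequence tau bond.
Proof.
move=> unb; split.
- move=> n; pose z : P n := Ordinal (m0 n).
  have tauk k : val (iter k (@tau n) z) = (k %% m n)%N.
    elim: k => [|k IH]; first by rewrite mod0n.
    by rewrite /= IH -addn1 modnDml addn1.
  exists z, (m n); split => //; first by apply: val_inj; rewrite tauk modnn.
  apply/seteqP; split=> // i _; exists (val i) => //; apply: val_inj.
  by rewrite tauk; exact: modn_small (ltn_ord i).
- move=> n i; apply: val_inj => /=.
  by rewrite modn_dvdm ?period_dvdn // -addn1 -modnDml addn1.
- apply/cvgnyPge => B; have [N BN] := unb B.
  exists N => // n /= Nn; rewrite card_ord (leq_trans (ltnW BN)) //.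
  exact: dvdn_leq (period_dvdn Nn).
Qed.

Lemma inverse_limit_phase (t : discrete_prod P) i n :
  inverse_limit bond t -> (i <= n)%N -> (t n : nat) = t i %[mod m i].
Proof.
move=> Bt /subnK <-; elim: (n - i)%N => // k IH.
rewrite addSn -IH -(Bt (k + i)%N) /= modn_dvdm // period_dvdn //.
exact: leq_addl.
Qed.

(** A coherent sequence [t] of phases is realised by a cluster point of the points
    of phase [t n] on the orbit of [x0].  The inverse map is continuous because
    points with the same [n]-th phase have the same [n]-th color, hence are
    [1 / (n + 1)]-close. *)
Lemma phase_conjugate : compact Y ->
  conjugate_on Y f (inverse_limit bond) (prod_map tau).
Proof.
move=> cY.
pose h x : discrete_prod P := fun n => Ordinal (ltn_pmod (theta n x) (m0 n)).
have hE x y n : Y x -> Y y -> h x n = h y n <-> c n x = c n y.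
  move=> Yx Yy; rewrite theta_inj //; split=> [/(congr1 val)//|thxy].
  exact: val_inj.
have hY : set_fun Y (inverse_limit bond) h.
  by move=> x Yx n; apply: val_inj; rewrite /= modn_dvdm ?period_dvdn // theta_refine.
have hinj x y : Y x -> Y y -> h x = h y -> x = y.
  by move=> Yx Yy hxy; apply: (@same_colors_eq 0) => n _; apply/hE; rewrite // hxy.
have lc n x : nbhs x [set y | c n y = c n x].
  by have [lcn _ _] := cc n; apply: filterS (lcn x I) => y; exact.
have hsurj t : inverse_limit bond t -> exists2 x, Y x & h x = t.
  move=> Bt.
  have [x Yx xcl] := compact_seq_cluster cY (fun n => Yiter (t n)).
  exists x => //; apply: functional_extensionality_dep => n; apply: val_inj => /=.
  have [j nj /thetaP-/(_ Yx) <-] := xcl _ n (lc n x).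
  by rewrite (inverse_limit_phase Bt nj) modn_small.
pose k t := xget x0 [set x | Y x /\ h x = t].
have kP t : inverse_limit bond t -> Y (k t) /\ h (k t) = t.
  move=> /hsurj[x Yx hx]; rewrite /k; case: xgetP => [y _ //|/(_ x)]; case; split => //.
have hf x : Y x -> h (f x) = prod_map tau (h x).
  move=> Yx; apply: functional_extensionality_dep => n; apply: val_inj => /=.
  by rewrite theta_step // -addn1 -modnDml addn1.
split.
- exact: fY.
- move=> t Bt n; rewrite /prod_map -(Bt n); apply: val_inj => /=.
  by rewrite modn_dvdm ?period_dvdn // -addn1 -modnDml addn1.
exists h, k; split => //.
- by split=> // t /kP[].
- split=> [x /set_mem Yx|t /set_mem/kP[]//].
  by have [Yk hk] := kP _ (hY _ Yx); exact: hinj.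
- apply/subspace_continuousP => x Yx; apply/cvg_sup => n U [V] [[W] oW <-] WhxU WU.
  apply: (filterS WU).
  rewrite nbhs_simpl /within /=; apply: filterS (lc n x) => y cyx Yy.
  have hyx : h y n = h x n by exact/hE.
  by change (W (h y n)); rewrite hyx.
- apply/subspace_continuousP => t Bt U /nbhs_ballP[e /= e0 eU].
  have [n _ ne] : \forall n \near \oo, (n.+1%:R^-1 : R) < e.
    exact: near_infty_natSinv_lt (PosNum e0).
  have tn : nbhs t [set s | s n = t n].
    exact: (@proj_continuous _ (fun n => discrete_topology (P n)) n t _
      (discrete_set1 (t n))).
  rewrite nbhs_simpl /within /=; apply: filterS tn => s st Bs.
  have [[Yt ht] [Ys hs]] := (kP t Bt, kP s Bs).
  apply: eU; rewrite ballEmdist /=; have [_ _ sc] := cc n.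
  apply: lt_trans (ne n (leqnn n)); apply: sc => //.
  by apply/hE => //; rewrite ht hs.
Qed.

Lemma phase_adding_machine : compact Y ->
  (forall B, exists n, (B < m n)%N) -> is_adding_machine f Y.
Proof.
move=> cY unb; exists P, tau, bond; split; first exact: cyclic_phases.
exact: phase_conjugate.
Qed.
End PhaseSystem.

(** * The equivalence *)

Section Main.
Context {R : realType} {X : metricType R}.

Lemma omega_limit_periodic_or_adding_machine (f : X -> X) p :
  compact [set: X] -> continuous f ->
  (forall e : R, 0 < e -> exists c : X -> set X, coloring f e [set: X] c) ->
  is_periodic_orbit f (omega_limit f p) \/ is_adding_machine f (omega_limit f p).
Proof.
move=> cX fc col; have [c [cc cref]] := refining_colorings col.
have fY := @omega_limit_invariant _ _ f p fc.
have cY : compact (omega_limit f p).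
  by apply: (subclosed_compact _ cX) => //; exact: omega_limit_closed.
have [x0 Yx0] := omega_limit_nonempty f p cX.
have phase n : exists mt : nat * (X -> nat), (0 < mt.1)%N /\
    forall x k, omega_limit f p x ->
      c n (iter k f x0) = c n x <-> k = mt.2 x %[mod mt.1].
  have [_ cf _] := cc n.
  have [m [t mt]] := phase_function fY Yx0 (fun x y _ _ => cf x y I I)
    (fun x y => omega_limit_transitive (cc n)).
  by exists (m, t).
have [mt mtP] := choice phase.
pose m n := (mt n).1.
have [bnd|unb] := pselect (exists B, forall n, (m n <= B)%N).
  left; apply: (bounded_periods_periodic_orbit fY Yx0 cc cref) bnd => n.
    exact: (mtP n).1.
  exact: (mtP n).2.
right; apply: (phase_adding_machine fY Yx0 cc cref (m := m)) => //.
- by move=> n; exact: (mtP n).1.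
- by move=> n; exact: (mtP n).2.
move=> B; apply: contrapT => nB; apply: unb; exists B => n.
by rewrite leqNgt; apply/negP => Bn; apply: nB; exists n.
Qed.
End Main.

Theorem theorem4 (R : realType) (X : metricType R) (f : X -> X)
    (Xcompact : compact [set: X])
    (Xdisc : totally_disconnected [set: X])
    (fcont : continuous f) :
  (forall e : R, 0 < e ->
     exists P : set (set X), dynamical_partition f e P)
  <->
  (forall p : X,
     (is_periodic_orbit f (omega_limit f p) \/
      is_adding_machine f (omega_limit f p)) /\
     clopen_stable f (omega_limit f p)).
Proof.
split=> [part p|omega e e0].
  have col e : 0 < e -> exists c : X -> set X, coloring f e [set: X] c.
    by move=> /part[P]; exact: dynamical_partition_colorable.
  split; first exact: omega_limit_periodic_or_adding_machine.
  by apply: colorable_clopen_stable => // e /col[c cc]; exists (set X), c.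
apply: colorable_dynamical_partition => //.
by apply: colorable_of_omega_limits; rewrite // divr_gt0.
Qed.
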